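(* Let $q\in(0,1)$. Then $$\lim_{n\to\infty}\big(P_n^q(S_n(\tau))\big)^{\frac1n}\ \text{ exists for all }\tau\in S_3.$$
   Context: $S_n$ is the set of permutations $\sigma=\sigma_1\cdots\sigma_n$ of $[n]=\{1,\dots,n\}$, where $\sigma_i=\sigma(i)$. For $\tau\in S_m$ with $2\le m\le n$, $\sigma\in S_n$ contains $\tau$ as a pattern if there are indices $1\le i_1<\cdots<i_m\le n$ such that for all $1\le j,k\le m$, $\sigma_{i_j}<\sigma_{i_k}$ if and only if $\tau_j<\tau_k$; otherwise $\sigma$ avoids $\tau$. $S_n(\tau)$ is the set of $\sigma\in S_n$ avoiding $\tau$ (and $S_n(\tau)=S_n$ if $m>n$). For $q>0$, the Mallows distribution with parameter $q$ is the probability measure on $S_n$ given by $P_n^q(\sigma)=q^{\mathrm{inv}(\sigma)}/Z_n(q)$, where $\mathrm{inv}(\sigma)$ is the number of inversions of $\sigma$, i.e. pairs $i<j$ with $\sigma_i>\sigma_j$, and $Z_n(q)=\sum_{\sigma\in S_n}q^{\mathrm{inv}(\sigma)}$, which for $q\neq 1$ equals $\prod_{k=1}^n\frac{1-q^k}{1-q}$. *)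

(* Defs.v *)
From HB Require Import structures.
From mathcomp Require Import all_boot all_order all_algebra all_fingroup.
From mathcomp Require Import all_classical all_reals all_analysis.
Set Implicit Arguments.
Unset Strict Implicit.
Unset Printing Implicit Defensive.
Import Order.TTheory GRing.Theory Num.Theory.
Import numFieldNormedType.Exports.

Local Open Scope ring_scope.

(* Permutations of {1, ..., n} are elements of 'S_n, with positions and values
   shifted to {0, ..., n-1}; every notion below depends only on their order. *)

Definition inv (n : nat) (s : 'S_n) : nat :=
  #|[set p : 'I_n * 'I_n | (p.1 < p.2)%N && (s p.2 < s p.1)%N]|.

(* [i] is the strictly increasing choice of indices i_1 < ... < i_m; when m > n
   there is none, so that every permutation avoids [tau]. *)
Definition contains_pattern (m n : nat) (tau : 'S_m) (s : 'S_n) : bool :=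
  [exists i : {ffun 'I_m -> 'I_n},
    [forall j : 'I_m, forall k : 'I_m, (j < k)%N ==> (i j < i k)%N] &&
    [forall j : 'I_m, forall k : 'I_m, (s (i j) < s (i k))%N == (tau j < tau k)%N]].

Definition avoiders (n m : nat) (tau : 'S_m) : {set 'S_n} :=
  [set s : 'S_n | ~~ contains_pattern tau s].

Definition mallowsZ (R : realType) (n : nat) (q : R) : R :=
  \sum_(s : 'S_n) q ^+ inv s.

Definition mallows (R : realType) (n : nat) (q : R) (A : {set 'S_n}) : R :=
  \sum_(s in A) q ^+ inv s / mallowsZ n q.

Lemma mallowsZ_gt0 (R : realType) (n : nat) (q : R) :
  0 < q -> 0 < mallowsZ n q.
Proof.
move=> q0; rewrite /mallowsZ (bigD1 1%g) //= ltr_pwDl ?exprn_gt0 //.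
by apply: sumr_ge0 => s _; rewrite exprn_ge0 // ltW.
Qed.

Lemma mallows_ge0 (R : realType) (n : nat) (q : R) (A : {set 'S_n}) :
  0 < q -> 0 <= mallows q A.
Proof.
move=> q0; apply: sumr_ge0 => s _.
by rewrite divr_ge0 ?exprn_ge0 ?ltW // mallowsZ_gt0.
Qed.

Lemma mallows_setT (R : realType) (n : nat) (q : R) :
  0 < q -> mallows q [set: 'S_n] = 1.
Proof.
move=> q0; rewrite /mallows -mulr_suml.
under eq_bigl do rewrite inE.
by rewrite mulfV // gt_eqF // mallowsZ_gt0.
Qed.

(* Main.v *)
(** Write [w_n] for the sum of [q ^ inv s] over the permutations of size [n]
    avoiding [tau]; the probability is [w_n / Z_n].

    If [tau] is not a nontrivial direct sum (231, 312, 321), its avoiders are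
    stable under direct sums.  Inversions add up under direct sums, so [w] is
    supermultiplicative and Fekete's lemma applies; the same argument applies
    to [Z], because [Z_n <= (1 - q) ^ (- n)] by the injectivity of the Lehmer
    code.

    The Lehmer code of a 132-avoiding permutation is nonincreasing, hence a
    partition of its number of inversions; counting partitions by their
    multiplicities gives [1 <= w_n <= C (n + 1)].  Reverse-complementation
    carries 213 to 132 and preserves inversions.

    In a 123-avoiding permutation every entry is smaller than all previous
    ones or larger than all later ones, so there are at least [n (n - 2) / 8]
    inversions and the limit is 0. *)
Require Import Defs.
From HB Require Import structures.
From mathcomp Require Import all_boot all_order all_algebra all_fingroup.
From mathcomp Require Import all_classical all_reals all_analysis.
From mathcomp Require Import ring lra zify.
Import Order.TTheory GRing.Theory Num.Theory.
Import numFieldNormedType.Exports.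
Local Open Scope ring_scope.

Local Notation inv := Defs.inv.

(** * Lehmer codes and an exponential bound on the normalising sum *)

Definition lehmer {n} (s : 'S_n) (i : 'I_n) : nat :=
  #|[set j : 'I_n | (i < j)%N && (s j < s i)%N]|.

Lemma lehmerE n (s : 'S_n) i :
  lehmer s i = (\sum_(j < n) ((i < j) && (s j < s i)))%N.
Proof.
by rewrite /lehmer -sum1_card big_mkcond; apply: eq_bigr => j _; rewrite inE; case: ifP.
Qed.

Lemma inv_lehmer n (s : 'S_n) : inv s = (\sum_i lehmer s i)%N.
Proof.
under eq_bigr do rewrite lehmerE.
rewrite pair_bigA /inv -sum1_card big_mkcond; apply: eq_bigr => -[i j] _.
by rewrite inE; case: ifP.
Qed.

Lemma lehmer_lt n (s : 'S_n) i : (lehmer s i < n)%N.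
Proof.
rewrite -[X in (_ < X)%N]card_ord -cardsT; apply: proper_card.
by apply/properP; split; [exact: finset.subsetT | exists i; rewrite ?inE ?ltnn].
Qed.

(** The code as a point of a finite type, so that a sum over all codes makes sense and factors into
    a product. *)
Definition lehmer_ffun {n} (s : 'S_n) : {ffun 'I_n -> 'I_n} :=
  [ffun i => Ordinal (lehmer_lt n s i)].

(* The values below [s i] that are not taken before position [i] are exactly
   those counted by [lehmer s i]; so [s i] is determined by [lehmer s i] and
   the previous values. *)
Lemma lehmer_lt_mono n (s t : 'S_n) (i : 'I_n) :
  (forall j : 'I_n, (j < i)%N -> s j = t j) -> (s i < t i)%N ->
  (lehmer s i < lehmer t i)%N.
Proof.
move=> st lt_i.
have imE (u : 'S_n) : lehmer u i = #|u @: [set j : 'I_n | (i < j)%N && (u j < u i)%N]|.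
  by rewrite card_imset //; apply: perm_inj.
have key (j : 'I_n) : (i <= j)%N -> (s j < t i)%N ->
    s j \in t @: [set k : 'I_n | (i < k)%N && (t k < t i)%N].
  move=> ij sj; apply/imsetP; exists (t^-1%g (s j)); rewrite ?permKV //.
  rewrite inE permKV sj andbT ltnNge leq_eqVlt negb_or; apply/andP; split.
    by apply/eqP => /val_inj e; move: sj; rewrite -e permKV ltnn.
  apply/negP => lt; have := st _ lt; rewrite permKV => /perm_inj e.
  by move: lt; rewrite e ltnNge ij.
rewrite !imE; apply: proper_card; apply/properP; split.
  apply/fintype.subsetP => x /imsetP[j]; rewrite inE => /andP[ij sj] ->.
  by apply: key; [exact: ltnW | exact: ltn_trans lt_i].
exists (s i); first exact: key.
by apply/negP => /imsetP[j]; rewrite inE => /andP[_ sj] e; move: sj; rewrite -e ltnn.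
Qed.

Lemma lehmer_inj n : injective (@lehmer_ffun n).
Proof.
move=> s t st.
have {}st i : lehmer s i = lehmer t i.
  by have /ffunP/(_ i) := st; rewrite !ffunE => /(congr1 val).
suff H k : forall i : 'I_n, (i < k)%N -> s i = t i.
  by apply/permP => i; apply: (H n).
elim: k => // k IH i; rewrite ltnS => ik.
have {}IH (j : 'I_n) : (j < i)%N -> s j = t j by move=> ji; apply: IH; apply: leq_trans ik.
case: (ltngtP (s i) (t i)) => [lt|lt|/val_inj//].
  by have := lehmer_lt_mono _ _ _ _ IH lt; rewrite st ltnn.
by have := lehmer_lt_mono _ _ _ _ (fun j ji => esym (IH j ji)) lt; rewrite st ltnn.
Qed.

Lemma geometric_le (R : realType) (q : R) n : 0 < q -> q < 1 ->
  \sum_(i < n) q ^+ i <= (1 - q)^-1.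
Proof.
move=> q0 q1; have p0 : 0 < 1 - q by rewrite subr_gt0.
rewrite -[leRHS]mul1r ler_pdivlMr // mulrC -opprB mulNr -subrX1 opprB.
by rewrite lerBlDr lerDl exprn_ge0 ?ltW.
Qed.

(** Serves to bound weights through injective codings: the terms being nonnegative, codes that do
    not occur only increase the sum. *)
Lemma ler_sum_inj (R : realType) (I J : finType) (A : {set I}) (B : {set J})
    (h : I -> J) (F : J -> R) :
  {in A &, injective h} -> {in A, forall i, h i \in B} -> (forall j, 0 <= F j) ->
  \sum_(i in A) F (h i) <= \sum_(j in B) F j.
Proof.
move=> h_inj hAB F0; rewrite -big_imset // [leRHS](big_setID (h @: A)) /=.
have /finset.setIidPr -> : h @: A \subset B.
  by apply/fintype.subsetP => _ /imsetP[i iA ->]; exact: hAB.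
by rewrite lerDl sumr_ge0.
Qed.

(** Lehmer codes are some of the functions from ['I_n] to itself, and the sum over all of these is
    the [n]-th power of a geometric sum. *)
Lemma mallowsZ_le (R : realType) (q : R) n : 0 < q -> q < 1 ->
  mallowsZ n q <= (1 - q)^-1 ^+ n.
Proof.
move=> q0 q1.
have -> : mallowsZ n q = \sum_(s in [set: 'S_n]) \prod_i q ^+ lehmer_ffun s i.
  apply: eq_big => [s|s _]; first by rewrite inE.
  by rewrite inv_lehmer expr_sum; apply: eq_bigr => i _; rewrite ffunE.
apply: le_trans (ler_sum_inj _ _ _ _ [set: {ffun 'I_n -> 'I_n}] _
  (fun f => \prod_i q ^+ f i) _ _ _) _.
- by move=> s t _ _; apply: lehmer_inj.
- by move=> s; rewrite !inE.
- by move=> f; apply: prodr_ge0 => i _; rewrite exprn_ge0 ?ltW.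
under eq_bigl do rewrite inE.
rewrite -(bigA_distr_bigA (fun i j : 'I_n => q ^+ j)) prodr_const card_ord.
have p0 : 0 <= \sum_(i < n) q ^+ i by apply: sumr_ge0 => i _; rewrite exprn_ge0 ?ltW.
by apply: lerXn2r; rewrite ?nnegrE ?geometric_le // (le_trans p0) ?geometric_le.
Qed.

(** * Weights and direct sums *)

Definition weight {R : realType} {n : nat} (q : R) (A : {set 'S_n}) : R :=
  \sum_(s in A) q ^+ inv s.

Lemma mallowsE (R : realType) n (q : R) (A : {set 'S_n}) :
  mallows q A = weight q A / mallowsZ n q.
Proof. by rewrite /mallows -mulr_suml. Qed.

Lemma weight_ge0 (R : realType) n (q : R) (A : {set 'S_n}) : 0 < q -> 0 <= weight q A.
Proof. by move=> q0; apply: sumr_ge0 => s _; rewrite exprn_ge0 ?ltW. Qed.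

Lemma weightT (R : realType) n (q : R) : weight q [set: 'S_n] = mallowsZ n q.
Proof. by apply: eq_bigl => s; rewrite inE. Qed.

Lemma weight_le (R : realType) n (q : R) (A : {set 'S_n}) : 0 < q ->
  weight q A <= mallowsZ n q.
Proof.
move=> q0; rewrite -weightT.
apply: (ler_sum_inj _ _ _ _ _ id) => // s.
by rewrite exprn_ge0 ?ltW.
Qed.

Lemma inv_sum n (s : 'S_n) :
  inv s = (\sum_(i < n) \sum_(j < n) ((i < j) && (s j < s i)))%N.
Proof. by rewrite inv_lehmer; apply: eq_bigr => i _; rewrite lehmerE. Qed.

Lemma inv1 n : inv (1%g : 'S_n) = 0%N.
Proof.
rewrite inv_sum big1 // => i _; rewrite big1 // => j _; rewrite !perm1.
by case: ltngtP.
Qed.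

Lemma weight_ge1 (R : realType) n (q : R) (A : {set 'S_n}) : 0 < q ->
  1%g \in A -> 1 <= weight q A.
Proof.
move=> q0 A1; rewrite /weight (bigD1 1%g) //= inv1 expr0 lerDl.
by apply: sumr_ge0 => s _; rewrite exprn_ge0 ?ltW.
Qed.

Definition dsum_fun {m n} (s : 'S_m) (t : 'S_n) (x : 'I_(m + n)) : 'I_(m + n) :=
  match fintype.split x with inl i => lshift n (s i) | inr j => rshift m (t j) end.

Lemma dsum_fun_inj m n (s : 'S_m) (t : 'S_n) : injective (dsum_fun s t).
Proof.
move=> x y; rewrite /dsum_fun -{2}(splitK x) -{2}(splitK y).
case: (fintype.split x) => i; case: (fintype.split y) => j /eqP.
- by rewrite eq_lshift => /eqP/perm_inj ->.
- by rewrite eq_lrshift.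
- by rewrite eq_sym eq_lrshift.
- by rewrite eq_rshift => /eqP/perm_inj ->.
Qed.

Definition dsum {m n} (s : 'S_m) (t : 'S_n) : 'S_(m + n) := perm (dsum_fun_inj m n s t).

Lemma dsum_lshift m n (s : 'S_m) (t : 'S_n) i : dsum s t (lshift n i) = lshift n (s i).
Proof. by rewrite permE /dsum_fun (unsplitK (inl i)). Qed.

Lemma dsum_rshift m n (s : 'S_m) (t : 'S_n) i : dsum s t (rshift m i) = rshift m (t i).
Proof. by rewrite permE /dsum_fun (unsplitK (inr i)). Qed.

Lemma dsum_inj m n : injective (fun p : 'S_m * 'S_n => dsum p.1 p.2).
Proof.
move=> [s t] [s' t'] /= /permP e; congr pair; apply/permP => i.
  by have := e (lshift n i); rewrite !dsum_lshift => /lshift_inj.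
by have := e (rshift m i); rewrite !dsum_rshift => /rshift_inj.
Qed.

(** The first block lies before and below the second, so no inversion has one entry in each. *)
Lemma inv_dsum m n (s : 'S_m) (t : 'S_n) : inv (dsum s t) = (inv s + inv t)%N.
Proof.
rewrite !inv_sum big_split_ord /=; congr addn; apply: eq_bigr => i _.
  rewrite big_split_ord /= [X in (_ + X)%N]big1 ?addn0 => [|j _].
    by apply: eq_bigr => j _; rewrite !dsum_lshift.
  by rewrite dsum_lshift dsum_rshift [X in _ && X]ltnNge /=
             (leq_trans (ltnW (ltn_ord _)) (leq_addr _ _)) andbF.
rewrite big_split_ord /= big1 ?add0n => [|j _].
  by apply: eq_bigr => j _; rewrite !dsum_rshift /= !ltn_add2l.
by rewrite [X in X && _]ltnNge /= (leq_trans (ltnW (ltn_ord _)) (leq_addr _ _)).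
Qed.

Lemma weight_dsum (R : realType) m n (q : R) (A : {set 'S_m}) (B : {set 'S_n})
    (C : {set 'S_(m + n)}) : 0 < q ->
  {in A & B, forall s t, dsum s t \in C} -> weight q A * weight q B <= weight q C.
Proof.
move=> q0 AB; rewrite /weight big_distrlr /= pair_big /=.
under eq_bigr do rewrite -exprD -inv_dsum.
have inj : {in finset.setX A B &, injective (fun p => dsum p.1 p.2)}.
  by move=> p p' _ _; exact: dsum_inj.
have sub : {in finset.setX A B, forall p, dsum p.1 p.2 \in C}.
  by move=> p; rewrite inE => /andP[? ?]; exact: AB.
apply: le_trans (ler_sum_inj _ _ _ _ _ _ (fun s => q ^+ inv s) inj sub _).
  by rewrite le_eqVlt; apply/orP; left; apply/eqP; apply: eq_bigl => p; rewrite inE.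
by move=> s; rewrite exprn_ge0 ?ltW.
Qed.

(** * Patterns of length three *)

Local Notation o0 := (@Ordinal 3 0 isT).
Local Notation o1 := (@Ordinal 3 1 isT).
Local Notation o2 := (@Ordinal 3 2 isT).

Lemma ord3P (P : 'I_3 -> Prop) : P o0 -> P o1 -> P o2 -> forall i, P i.
Proof.
move=> P0 P1 P2 [[|[|[|//]]] lt]; [have -> : lt = isT by exact: bool_irrelevance..].
- exact: P0.
- exact: P1.
- exact: P2.
Qed.

Lemma perm3 (tau : 'S_3) :
  [/\ tau o0 != tau o1 :> nat, tau o0 != tau o2 :> nat & tau o1 != tau o2 :> nat].
Proof. by split; apply/eqP => /val_inj/perm_inj. Qed.

(** Three comparisons suffice: values at distinct positions differ, so each reverse comparison is a
    negation. *)
Lemma contains_pattern3 n (tau : 'S_3) (s : 'S_n) (i j k : 'I_n) :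
  (i < j)%N -> (j < k)%N -> (s i < s j)%N = (tau o0 < tau o1)%N ->
  (s i < s k)%N = (tau o0 < tau o2)%N -> (s j < s k)%N = (tau o1 < tau o2)%N ->
  contains_pattern tau s.
Proof.
move=> ij jk e01 e02 e12.
have ik := ltn_trans ij jk.
have [t01 t02 t12] := perm3 tau.
have neq (x y : 'I_n) : (x < y)%N -> (s y < s x)%N = ~~ (s x < s y)%N.
  move=> xy; case: ltngtP => // /val_inj/perm_inj e.
  by move: xy; rewrite e ltnn.
apply/existsP; exists [ffun x : 'I_3 => nth i [:: i; j; k] x].
apply/andP; split.
  apply/forallP; apply: ord3P; apply/forallP; apply: ord3P; apply/implyP => //=;
  by rewrite !ffunE /=.
apply/forallP; apply: ord3P; apply/forallP; apply: ord3P;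
  by rewrite !ffunE /= ?ltnn ?(neq _ _ ij) ?(neq _ _ jk) ?(neq _ _ ik) ?e01 ?e02 ?e12 //; lia.
Qed.

Lemma contains_patternP n (tau : 'S_3) (s : 'S_n) : contains_pattern tau s ->
  exists i : 'I_3 -> 'I_n, [/\ (i o0 < i o1)%N, (i o1 < i o2)%N &
    forall a b, (s (i a) < s (i b))%N = (tau a < tau b)%N].
Proof.
move=> /existsP[i /andP[/forallP mono /forallP eqs]]; exists i; split.
- by move/forallP: (mono o0) => /(_ o1).
- by move/forallP: (mono o1) => /(_ o2).
- by move=> a b; move/forallP: (eqs a) => /(_ b)/eqP.
Qed.

Lemma avoiders1 n (tau : 'S_3) : ~~ ((tau o0 < tau o1)%N && (tau o1 < tau o2)%N) ->
  1%g \in avoiders n tau.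
Proof.
move=> tauN; rewrite inE; apply: contra tauN => /contains_patternP[i [i01 i12 e]].
by rewrite -!e !perm1 i01.
Qed.

(** For length three, not starting with the minimum and not ending with the maximum means not being
    a nontrivial direct sum. An occurrence of such a pattern must stay inside one block. *)
Lemma avoiders_dsum m n (tau : 'S_3) (s : 'S_m) (t : 'S_n) :
  tau o0 != 0%N :> nat -> tau o2 != 2%N :> nat ->
  s \in avoiders m tau -> t \in avoiders n tau -> dsum s t \in avoiders (m + n) tau.
Proof.
move=> tau0 tau2; rewrite !inE => sN tN; apply/negP => /contains_patternP[i [i01 i12 e]].
have [t01 t02 t12] := perm3 tau.
have [l0 l1 l2] : [/\ (tau o0 < 3)%N, (tau o1 < 3)%N & (tau o2 < 3)%N] by split.
have dl x : ((dsum s t x < m) = (x < m))%N.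
  rewrite -(splitK x); case: (fintype.split x) => y /=.
    by rewrite dsum_lshift /= !ltn_ord.
  by rewrite dsum_rshift /= !ltnNge !leq_addr.
have mem1 (x : 'I_(m + n)) : (x < m)%N -> exists y, x = lshift n y.
  by move=> lt; exists (Ordinal lt); apply: val_inj.
have mem2 (x : 'I_(m + n)) : (m <= x)%N -> exists y, x = rshift m y.
  move=> le; have lt : (x - m < n)%N by have := ltn_ord x; lia.
  by exists (Ordinal lt); apply: val_inj; rewrite /= subnKC.
case: (ltnP (i o2) m) => [i2|i2].
  have [y2 e2] := mem1 _ i2.
  have [y1 e1] := mem1 _ (ltn_trans i12 i2).
  have [y0 e0] := mem1 _ (ltn_trans i01 (ltn_trans i12 i2)).
  move/negP: sN; apply; apply: (contains_pattern3 _ _ _ y0 y1 y2).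
  - by move: i01; rewrite e0 e1.
  - by move: i12; rewrite e1 e2.
  - by have := e o0 o1; rewrite e0 e1 !dsum_lshift.
  - by have := e o0 o2; rewrite e0 e2 !dsum_lshift.
  - by have := e o1 o2; rewrite e1 e2 !dsum_lshift.
case: (ltnP (i o0) m) => [i0|i0]; last first.
  have [y0 e0] := mem2 _ i0.
  have [y1 e1] := mem2 _ (leq_trans i0 (ltnW i01)).
  have [y2 e2] := mem2 _ i2.
  move/negP: tN; apply; apply: (contains_pattern3 _ _ _ y0 y1 y2).
  - by move: i01; rewrite e0 e1 /= ltn_add2l.
  - by move: i12; rewrite e1 e2 /= ltn_add2l.
  - by have := e o0 o1; rewrite e0 e1 !dsum_rshift /= ltn_add2l.
  - by have := e o0 o2; rewrite e0 e2 !dsum_rshift /= ltn_add2l.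
  - by have := e o1 o2; rewrite e1 e2 !dsum_rshift /= ltn_add2l.
(* The occurrence now meets both blocks, which cuts [tau] into a lower initial part and a higher
   final part; either possible cut contradicts [tau0] or [tau2]. *)
have lt_across a b : (i a < m)%N -> (m <= i b)%N -> (tau a < tau b)%N.
  move=> ia ib; rewrite -e; apply: (@leq_trans m); first by rewrite dl.
  by rewrite leqNgt dl -leqNgt.
have := lt_across _ _ i0 i2.
case: (ltnP (i o1) m) => [i1|i1].
  by have := lt_across _ _ i1 i2; lia.
by have := lt_across _ _ i0 i1; lia.
Qed.

(** * Nonincreasing Lehmer codes as partitions *)

Definition mult {n} (s : 'S_n) (v : 'I_n) : nat := #|[set i | lehmer_ffun s i == v]|.

Lemma mult_lt n (s : 'S_n) v : (mult s v < n.+1)%N.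
Proof. by rewrite ltnS -[X in (_ <= X)%N]card_ord; apply: max_card. Qed.

Definition mult_ffun {n} (s : 'S_n) : {ffun 'I_n -> 'I_n.+1} :=
  [ffun v => Ordinal (mult_lt n s v)].

Lemma inv_mult n (s : 'S_n) : inv s = (\sum_(v < n) v * mult s v)%N.
Proof.
rewrite inv_lehmer (partition_big (lehmer_ffun s) predT) //=.
apply: eq_bigr => v _; rewrite (eq_bigr (fun=> val v)).
  by rewrite sum_nat_const mulnC /mult; congr muln; apply: eq_card => i; rewrite !inE.
by move=> i /eqP <-; rewrite ffunE.
Qed.

(** A nonincreasing code is a sorted list, hence determined by its multiplicities. *)
Lemma mult_inj n (s t : 'S_n) :
  (forall i j : 'I_n, (i < j)%N -> (lehmer s j <= lehmer s i)%N) ->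
  (forall i j : 'I_n, (i < j)%N -> (lehmer t j <= lehmer t i)%N) ->
  mult_ffun s = mult_ffun t -> s = t.
Proof.
move=> s_mono t_mono st; apply: lehmer_inj.
have {}st v : mult s v = mult t v.
  by have /ffunP/(_ v) := st; rewrite !ffunE => /(congr1 val).
pose r : rel 'I_n := fun x y => (y <= x)%N.
have sortedE (u : 'S_n) : (forall i j : 'I_n, (i < j)%N -> (lehmer u j <= lehmer u i)%N) ->
    sorted r (codom (lehmer_ffun u)).
  move=> u_mono; apply: pairwise_sorted; rewrite codomE pairwise_map.
  have := iota_ltn_sorted 0 n.
  rewrite (sorted_pairwise ltn_trans) -val_enum_ord pairwise_map.
  by apply: sub_pairwise => i j ij; rewrite /r /= !ffunE; exact: u_mono.
have countE (u : 'S_n) v : count_mem v (codom (lehmer_ffun u)) = mult u v.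
  rewrite /mult -sum1_card -sum1_count codomE big_map big_enum_cond /=.
  by apply: eq_bigl => i; rewrite inE.
have : codom (lehmer_ffun s) = codom (lehmer_ffun t).
  apply: (sorted_eq (leT := r)); rewrite ?sortedE //.
  - by move=> x y z yx zy; exact: leq_trans zy yx.
  - by move=> x y /anti_leq/val_inj.
  - by apply/allP => v _; rewrite /= !countE st.
by rewrite !codom_ffun => /val_inj/(congr1 Finfun); rewrite !fgraphK.
Qed.

(** Summing over all multiplicities gives a product over [v] of geometric sums of ratio [q ^+ v], a
    truncation of Euler's product for partitions. *)
Lemma weight_lehmer_mono (R : realType) (q : R) n (A : {set 'S_n}) : 0 < q -> q < 1 ->
  {in A, forall (s : 'S_n) (i j : 'I_n), (i < j)%N -> (lehmer s j <= lehmer s i)%N} ->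
  weight q A <= n.+1%:R * expR ((1 - q)^-1 ^+ 2).
Proof.
move=> q0 q1 A_mono; have p0 : 0 < 1 - q by rewrite subr_gt0.
have q0' := ltW q0.
pose G (g : {ffun 'I_n -> 'I_n.+1}) := \prod_(v < n) (q ^+ v) ^+ g v.
have -> : weight q A = \sum_(s in A) G (mult_ffun s).
  apply: eq_bigr => s _; rewrite inv_mult expr_sum; apply: eq_bigr => v _.
  by rewrite exprM ffunE.
apply: le_trans (ler_sum_inj _ _ _ _ [set: {ffun 'I_n -> 'I_n.+1}] _ G _ _ _) _.
- by move=> s t sA tA; apply: mult_inj; exact: A_mono.
- by move=> s; rewrite !inE.
- by move=> g; apply: prodr_ge0 => v _; rewrite !exprn_ge0.
under eq_bigl do rewrite inE.
rewrite -(bigA_distr_bigA (fun (v : 'I_n) (k : 'I_n.+1) => (q ^+ v) ^+ k)) /=.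
have F0 (v : nat) : 0 <= \sum_(k < n.+1) (q ^+ v) ^+ k.
  by apply: sumr_ge0 => k _; rewrite !exprn_ge0.
(* With [x = q ^+ v.+1 <= q], one has [1 / (1 - x) <= 1 + x / (1 - q) <= expR (x / (1 - q))]; the
   exponents then sum to at most [(1 - q)^-1 ^+ 2]. *)
have F_le (v : nat) : \sum_(k < n.+1) (q ^+ v.+1) ^+ k <= expR (q ^+ v.+1 / (1 - q)).
  have qv0 : 0 < q ^+ v.+1 by rewrite exprn_gt0.
  have qv_le : q ^+ v.+1 <= q by rewrite exprS ler_piMr // exprn_ile1 // ltW.
  apply: le_trans (geometric_le _ _ _ qv0 (le_lt_trans qv_le q1)) _.
  apply: le_trans (expR_ge1Dx _).
  rewrite -[leLHS]mul1r ler_pdivrMr; last by lra.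
  rewrite mulrDl mul1r.
  have -> : q ^+ v.+1 / (1 - q) * (1 - q ^+ v.+1) =
      q ^+ v.+1 * ((1 - q ^+ v.+1) / (1 - q)) by ring.
  suff : q ^+ v.+1 <= q ^+ v.+1 * ((1 - q ^+ v.+1) / (1 - q)) by lra.
  by rewrite ler_peMr ?(ltW qv0) // ler_pdivlMr //; lra.
case: n F0 F_le {A A_mono G} => [|n] F0 F_le.
  by rewrite big_ord0 mul1r -[leLHS]expR0 ler_expR exprn_ge0 // invr_ge0 (ltW p0).
(* The factor for code entries equal to 0 has ratio 1 and accounts for the linear term. *)
rewrite big_ord_recl /=; apply: ler_pM; rewrite ?F0 //.
- by apply: prodr_ge0 => v _; exact: F0.
- by under eq_bigr do rewrite expr0 expr1n; rewrite sumr_const card_ord.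
apply: le_trans (_ : \prod_(v < n) expR (q ^+ v.+1 / (1 - q)) <= _).
  by apply: ler_prod => v _; rewrite F0 F_le.
rewrite -expR_sum ler_expR -mulr_suml exprS expr1 ler_wpM2r ?invr_ge0 ?(ltW p0) //.
apply: le_trans (geometric_le _ _ n q0 q1); apply: ler_sum => v _.
by rewrite exprS ler_piMl ?exprn_ge0 // ltW.
Qed.

(** An entry after [j] and below [s j] is also below [s i], since otherwise it would complete a 132;
    so the set counted at [j] is contained in the one counted at [i]. *)
Lemma lehmer_mono n (s : 'S_n) :
  (forall i j k : 'I_n, (i < j)%N -> (j < k)%N -> ~~ ((s i < s k)%N && (s k < s j)%N)) ->
  forall i j : 'I_n, (i < j)%N -> (lehmer s j <= lehmer s i)%N.
Proof.
move=> sN i j ij; apply: subset_leq_card; apply/fintype.subsetP => k.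
rewrite !inE => /andP[jk kj]; rewrite (ltn_trans ij jk) /= ltnNge leq_eqVlt negb_or.
apply/andP; split.
  by apply/eqP => /val_inj/perm_inj e; move: (ltn_trans ij jk); rewrite e ltnn.
by have := sN _ _ _ ij jk; rewrite kj andbT.
Qed.

(** * Reverse-complementation *)

Lemma rev_perm_inj n (s : 'S_n) : injective (fun i => rev_ord (s (rev_ord i))).
Proof. by move=> i j /rev_ord_inj/perm_inj/rev_ord_inj. Qed.

Definition rev_compl {n} (s : 'S_n) : 'S_n := perm (rev_perm_inj n s).

Lemma rev_compl_inj n : injective (@rev_compl n).
Proof.
move=> s t /permP e; apply/permP => i.
by have := e (rev_ord i); rewrite !permE /= rev_ordK => /rev_ord_inj.
Qed.

Lemma ltn_rev_ord n (i j : 'I_n) : (rev_ord i < rev_ord j)%N = (j < i)%N.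
Proof. by have := ltn_ord i; have := ltn_ord j; rewrite /=; lia. Qed.

(** Positions and values are both reversed, so an inversion stays one with its two ends swapped,
    whence the exchange of sums. *)
Lemma inv_rev_compl n (s : 'S_n) : inv (rev_compl s) = inv s.
Proof.
rewrite !inv_sum (reindex_inj rev_ord_inj) /= exchange_big (reindex_inj rev_ord_inj) /=.
apply: eq_bigr => i _; apply: eq_bigr => j _.
by rewrite !permE !rev_ordK !ltn_rev_ord.
Qed.

Lemma weight_rev_compl (R : realType) (q : R) n (A : {set 'S_n}) :
  weight q (rev_compl @: A) = weight q A.
Proof.
rewrite /weight big_imset /=; last by move=> s t _ _; exact: rev_compl_inj.
by apply: eq_bigr => s _; rewrite inv_rev_compl.
Qed.

(** * Inversions of 123-avoiding permutations *)

Lemma sum_ltn_ord n (m : nat) : (m <= n)%N -> (\sum_(i < n) (i < m) = m)%N.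
Proof.
move=> mn; rewrite (eq_bigr (fun i : 'I_n => if (i < m)%N then 1%N else 0%N)); last first.
  by move=> i _; case: ifP.
by rewrite -big_mkcond -(big_ord_widen n (fun=> 1%N) mn) big_const_ord iter_addn_0 mul1n.
Qed.

(** Induction in steps of two: without its two end terms, the sum for [n + 2] is the one for [n]
    with every term raised by 1. *)
Lemma sum_minn_ge n : (n * (n - 2) <= 4 * \sum_(j < n) minn j (n.-1 - j))%N.
Proof.
elim/ltn_ind: n => -[|[|n]] IH //.
rewrite big_ord_recl big_ord_recr /= min0n add0n.
rewrite (eq_bigr (fun j : 'I_n => minn j (n.-1 - j) + 1)%N); last first.
  move=> j _; have := ltn_ord j; rewrite /bump /= addn_minl => jn.
  by congr minn; lia.
rewrite big_split /= big_const_ord iter_addn_0 mul1n.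
apply: leq_trans (leq_mul (leqnn 4) (leq_addr _ _)).
have := IH n (leqnSn _); move: (\sum_(j < n) _)%N => S.
rewrite mulnDr => IHS; apply: leq_trans (leq_add IHS (leqnn _)).
by case: n {IH IHS} => [|[|n]] //; rewrite !subSS !subn0; nia.
Qed.

Lemma inv_ge n (s : 'S_n) :
  (forall i j k : 'I_n, (i < j)%N -> (j < k)%N -> ~~ ((s i < s j)%N && (s j < s k)%N)) ->
  (n * (n - 2) <= 8 * inv s)%N.
Proof.
move=> sN; apply: leq_trans (sum_minn_ge n) _.
(* Each inversion is counted at both ends. Position [j] ends [j] inversions if no earlier entry is
   smaller, and otherwise starts [n.-1 - j] of them. *)
rewrite -[8%N]/(4 * 2)%N -mulnA leq_pmul2l // mul2n -addnn {1}inv_sum inv_sum.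
rewrite [X in (_ <= X + _)%N]exchange_big -big_split /=; apply: leq_sum => j _.
have gt_neq (i k : 'I_n) : (i < k)%N -> ~~ (s i < s k)%N -> (s k < s i)%N.
  move=> ik; case: ltngtP => // /val_inj/perm_inj e _.
  by move: ik; rewrite e ltnn.
have [/existsP[i /andP[ij sij]]|] := boolP [exists i : 'I_n, (i < j)%N && (s i < s j)%N].
  apply: leq_trans (geq_minr _ _) _; apply: leq_trans (leq_addl _ _).
  rewrite (eq_bigr (fun k : 'I_n => (j < k)%N : nat)); last first.
    move=> k _; case: ltnP => //= jk; rewrite gt_neq //.
    by have := sN _ _ _ ij jk; rewrite sij.
  rewrite (reindex_inj rev_ord_inj) /= (eq_bigr (fun k : 'I_n => (k < n.-1 - j)%N : nat)).
    by rewrite sum_ltn_ord // leq_subLR; lia.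
  by move=> k _; congr nat_of_bool; have := ltn_ord k; have := ltn_ord j; lia.
rewrite negb_exists => /forallP no.
apply: leq_trans (geq_minl _ _) _; apply: leq_trans (leq_addr _ _).
rewrite (eq_bigr (fun i : 'I_n => (i < j)%N : nat)).
  by rewrite sum_ltn_ord // ltnW.
move=> i _; case: ltnP => //= ij; rewrite gt_neq //.
by have := no i; rewrite ij.
Qed.

(** Each term is split into two equal factors [p ^+ (8 * inv s)]: one is at most
    [p ^+ (n * (n - 2))], the other is summed by [mallowsZ_le]. The [n]-th root of the bound tends
    to 0. *)
Lemma weight_le_expn (R : realType) (p : R) n (A : {set 'S_n}) : 0 < p -> p < 1 ->
  {in A, forall s : 'S_n, (n * (n - 2) <= 8 * inv s)%N} ->
  weight (p ^+ 16) A <= (p ^+ (n - 2) * (1 - p ^+ 8)^-1) ^+ n.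
Proof.
move=> p0 p1 Ainv.
have p8 : p ^+ 8 < 1 by rewrite exprn_ilt1 // ltW.
have p80 : 0 < p ^+ 8 by rewrite exprn_gt0.
rewrite exprMn -exprM mulnC.
apply: le_trans (_ : p ^+ (n * (n - 2)) * mallowsZ n (p ^+ 8) <= _); last first.
  by apply: ler_wpM2l; rewrite ?exprn_ge0 ?(ltW p0) // mallowsZ_le.
apply: le_trans (_ : p ^+ (n * (n - 2)) * weight (p ^+ 8) A <= _); last first.
  by apply: ler_wpM2l; rewrite ?exprn_ge0 ?(ltW p0) // weight_le.
rewrite /weight mulr_sumr; apply: ler_sum => s sA.
rewrite -[16%N]/(8 + 8)%N exprD exprMn ler_wpM2r ?exprn_ge0 ?(ltW p0) //.
by rewrite -exprM ler_wiXn2l ?Ainv // ltW.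
Qed.

(** * Growth rates and limits *)

Local Open Scope classical_set_scope.

(** The limit is the supremum of [b m / m] over [m > 0]. For a nearly optimal [m], division of [n]
    by [m] gives [b n >= (n %/ m) * b m], the remainder contributing a nonnegative amount. *)
Lemma fekete (R : realType) (b : nat -> R) (c : R) :
  (forall n, 0 <= b n) -> (forall m n, b m + b n <= b (m + n)%N) ->
  (forall n, b n <= c * n%:R) -> exists l : R, b n / n%:R @[n --> \oo] --> l.
Proof.
move=> b_ge0 bD b_le.
pose E := [set b m / m%:R | m in [set m | (0 < m)%N]].
have Eub : has_ubound E.
  by exists c => _ [m /= m0 <-]; rewrite ler_pdivrMr ?ltr0n.
have E0 : E !=set0 by exists (b 1%N / 1%:R), 1%N.
have bM m k : b m *+ k <= b (k * m)%N.
  elim: k => [|k IH]; first by rewrite mulr0n.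
  by rewrite mulrS mulSn; apply: le_trans (bD _ _); rewrite lerD2l.
exists (sup E); apply/cvgrPdist_le => e e0.
have e20 : 0 < e / 2 by rewrite divr_gt0.
have [_ [m /= m0 <-] Hm] := sup_adherent e20 (conj E0 Eub).
near=> n.
have n0 : (0 < n)%N by near: n; exists 1%N.
have n0R : 0 < n%:R :> R by rewrite ltr0n.
have m0R : 0 < m%:R :> R by rewrite ltr0n.
(* Replacing [n %/ m] by [n / m] loses at most one [b m], which is at most [n * (e / 2)] here. *)
have nE : b m / (e / 2) <= n%:R by near: n; exact: nbhs_infty_ger.
have le_sup : b n / n%:R <= sup E by apply: (ub_le_sup Eub); exists n.
rewrite ger0_norm ?subr_ge0 // lerBlDr -lerBlDl ler_pdivlMr //.
move: nE; rewrite ler_pdivrMr // => nE.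
have divE : n%:R / m%:R <= (n %/ m)%:R + 1 :> R.
  by rewrite natr1 ler_pdivrMr // -natrM ler_nat ltnW // ltn_ceil.
have bn : b m *+ (n %/ m) <= b n.
  apply: le_trans (bM _ _) _; rewrite [n in leRHS](divn_eq n m).
  by apply: le_trans (bD _ _); rewrite lerDl.
have := ler_wpM2r (b_ge0 m) divE.
rewrite mulrDl mul1r -mulrA (mulrC m%:R^-1) => bn'.
move: bn; rewrite -mulr_natl => bn.
have := ler_wpM2r (ltW n0R) (ltW Hm).
rewrite mulrC => ?; lra.
Unshelve. all: by end_near. Qed.

Lemma cvg_powR_inv (R : realType) (a : nat -> R) (l : R) : (forall n, 0 < a n) ->
  ln (a n) / n%:R @[n --> \oo] --> l -> a n `^ n%:R^-1 @[n --> \oo] --> expR l.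
Proof.
move=> a0 al; under eq_fun do rewrite /powR gt_eqF ?a0 // mulrC.
apply: (cvg_comp _ _ al); exact: continuous_expR.
Qed.

(** The logarithms of the weights are superadditive by [weight_dsum], nonnegative because of the
    identity, and linearly bounded by [mallowsZ_le]. *)
Lemma weight_growth (R : realType) (q : R) (A : forall n, {set 'S_n}) :
  0 < q -> q < 1 -> (forall n, 1%g \in A n) ->
  (forall m n, {in A m & A n, forall s t, dsum s t \in A (m + n)%N}) ->
  exists l : R, ln (weight q (A n)) / n%:R @[n --> \oo] --> l.
Proof.
move=> q0 q1 A1 AD.
have w1 n : 1 <= weight q (A n) by exact: weight_ge1.
have w0 n : 0 < weight q (A n) := lt_le_trans ltr01 (w1 n).
have p0 : 0 < (1 - q)^-1 by rewrite invr_gt0 subr_gt0.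
apply: (fekete _ _ (ln (1 - q)^-1)) => [n|m n|n].
- exact: ln_ge0.
- rewrite -lnM ?posrE // ler_ln ?posrE ?mulr_gt0 //.
  by apply: weight_dsum => //; exact: AD.
- rewrite mulr_natr -lnXn // ler_ln ?posrE ?exprn_gt0 //.
  exact: le_trans (weight_le _ _ _ _ q0) (mallowsZ_le _ _ _ q0 q1).
Qed.

Lemma mallows_growth (R : realType) (q l : R) (A : forall n, {set 'S_n}) :
  0 < q -> q < 1 -> (forall n, 0 < weight q (A n)) ->
  ln (weight q (A n)) / n%:R @[n --> \oo] --> l ->
  exists l' : R, mallows q (A n) `^ n%:R^-1 @[n --> \oo] --> l'.
Proof.
move=> q0 q1 w0 wl.
(* The normalising sum is the weight of all permutations, trivially stable under direct sums. *)
have [z zl] : exists z : R,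
    ln (weight q [set: 'S_n]%SET) / n%:R @[n --> \oo] --> z.
  by apply: (weight_growth _ _ (fun n => [set: 'S_n]%SET)) => // m n s t _ _; rewrite inE.
exists (expR (l - z)); apply: cvg_powR_inv.
  by move=> n; rewrite mallowsE divr_gt0 ?mallowsZ_gt0.
have -> : (fun n => ln (mallows q (A n)) / n%:R) =
    (fun n => ln (weight q (A n)) / n%:R - ln (weight q [set: 'S_n]%SET) / n%:R).
  apply/funext => n; rewrite mallowsE ln_div ?posrE ?mallowsZ_gt0 //.
  by rewrite weightT mulrBl.
exact: cvgB.
Qed.

(** Applying [ln x <= x] to [x = (e / 2 / C) * w n] bounds [ln (w n)] by [(e / 2) * (n + 1)] plus a
    constant. *)
Lemma cvg_ln_linear (R : realType) (w : nat -> R) (C : R) : 0 < C ->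
  (forall n, 1 <= w n) -> (forall n, w n <= n.+1%:R * C) ->
  ln (w n) / n%:R @[n --> \oo] --> (0 : R).
Proof.
move=> C0 w1 wC; apply/cvgrPdist_le => e e0.
have w0 n : 0 < w n := lt_le_trans ltr01 (w1 n).
have e20 : 0 < e / 2 by rewrite divr_gt0.
have d0 : 0 < e / 2 / C by rewrite divr_gt0.
near=> n.
have n0R : 0 < n%:R :> R by rewrite ltr0n; near: n; exists 1%N.
have : (e / 2 - ln (e / 2 / C)) / (e / 2) <= n%:R by near: n; exact: nbhs_infty_ger.
rewrite ler_pdivrMr // => ne.
rewrite sub0r normrN ger0_norm ?divr_ge0 ?ln_ge0 // ler_pdivrMr //.
have := ln_sublinear (mulr_gt0 d0 (w0 n)); rewrite lnM ?posrE //.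
have : e / 2 / C * w n <= e / 2 * n.+1%:R.
  by rewrite mulrAC ler_pdivrMr // -[leRHS]mulrA ler_wpM2l // ltW.
rewrite -[n.+1%:R]natr1; lra.
Unshelve. all: by end_near. Qed.

Lemma mallows_root_cvg0 (R : realType) (q : R) (A : forall n, {set 'S_n}) :
  0 < q -> q < 1 ->
  (forall n, {in A n, forall s : 'S_n, (n * (n - 2) <= 8 * inv s)%N}) ->
  mallows q (A n) `^ n%:R^-1 @[n --> \oo] --> (0 : R).
Proof.
move=> q0 q1 Ainv.
pose p := q `^ 16%:R^-1.
have p0 : 0 < p by rewrite powR_gt0.
have pq : p ^+ 16 = q.
  by rewrite -powR_mulrn ?ltW // -powRrM mulVf ?pnatr_eq0 // powRr1 // ltW.
have p1 : p < 1.
  by rewrite ltNge; apply/negP => p1; move: q1; rewrite -pq ltNge exprn_ege1.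
pose D := (1 - p ^+ 8)^-1.
have D0 : 0 <= D by rewrite invr_ge0 subr_ge0 exprn_ile1 // ltW.
(* This majorant equals [p ^+ (n - 2) * D] once [n >= 2], and is visibly geometric. *)
apply: (@squeeze_cvgr _ _ _ _ (fun=> 0) (fun n => p ^+ n * (p ^- 2 * D))).
- near=> n.
  have n2 : (2 <= n)%N by near: n; exists 2%N.
  have n0 : n%:R != 0 :> R by rewrite pnatr_eq0; lia.
  rewrite powR_ge0 /=.
  have -> : p ^+ n * (p ^- 2 * D) = p ^+ (n - 2) * D.
    by rewrite mulrA -[in LHS](subnK n2) exprD mulfK // expf_neq0 // gt_eqF.
  set x := p ^+ (n - 2) * D.
  have x0 : 0 <= x by rewrite mulr_ge0 // exprn_ge0 // ltW.
  have xE : x = (x ^+ n) `^ n%:R^-1.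
    by rewrite -powR_mulrn // -powRrM mulfV // powRr1.
  rewrite [leRHS]xE; apply: ge0_ler_powR; rewrite ?nnegrE ?exprn_ge0 ?mallows_ge0 //.
  apply: le_trans (_ : weight q (A n) <= _).
    rewrite mallowsE ler_pdivrMr ?mallowsZ_gt0 // ler_peMr ?weight_ge0 //.
    by rewrite -weightT weight_ge1 // inE.
  by rewrite -pq; apply: weight_le_expn => //; exact: Ainv.
- exact: cvg_cst.
- rewrite -[X in _ --> X](mul0r (p ^- 2 * D)); apply: cvgMr_tmp.
  by apply: cvg_expr; rewrite ger0_norm // ltW.
Unshelve. all: by end_near. Qed.

(** * The six patterns *)

Theorem proposition3 (R : realType) (q : R) (hq0 : 0 < q) (hq1 : q < 1) :
  forall tau : 'S_3,
    exists l : R,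
      (fun n : nat => mallows q (avoiders n tau) `^ (n%:R^-1)) @ \oo --> l.
Proof.
move=> tau.
have [t01 t02 t12] := perm3 tau.
have [l0 l1 l2] : [/\ (tau o0 < 3)%N, (tau o1 < 3)%N & (tau o2 < 3)%N] by split.
have avoid n (s : 'S_n) (i j k : 'I_n) : s \in avoiders n tau -> (i < j)%N -> (j < k)%N ->
    ~~ [&& (s i < s j)%N == (tau o0 < tau o1)%N, (s i < s k)%N == (tau o0 < tau o2)%N &
         (s j < s k)%N == (tau o1 < tau o2)%N].
  rewrite inE => sN ij jk; apply: contra sN => /and3P[/eqP ? /eqP ? /eqP ?].
  exact: (contains_pattern3 _ _ _ i j k).
(* First 123; every other pattern is avoided by the identity, so its weights are at least 1. *)
case: (boolP ((tau o0 < tau o1)%N && (tau o1 < tau o2)%N)) => [/andP[t01' t12']|tauN].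
  exists 0; apply: mallows_root_cvg0 => // n s sA; apply: inv_ge => i j k ij jk.
  apply: contra (avoid _ _ _ _ _ sA ij jk) => /andP[sij sjk].
  by rewrite sij sjk (ltn_trans sij sjk) t01' t12' (ltn_trans t01' t12').
have w1 n : 1 <= weight q (avoiders n tau) by apply: weight_ge1 => //; exact: avoiders1.
have w0 n : 0 < weight q (avoiders n tau) := lt_le_trans ltr01 (w1 n).
suff [l wl] : exists l : R, ln (weight q (avoiders n tau)) / n%:R @[n --> \oo] --> l.
  exact: (mallows_growth _ _ _ (fun n => avoiders n tau)) wl.
have C0 : 0 < expR ((1 - q)^-1 ^+ 2) by exact: expR_gt0.
(* Starting with the minimum leaves only 132. *)
case: (eqVneq (tau o0 : nat) 0%N) => [t0|t0].
  exists 0; apply: (cvg_ln_linear _ _ _ C0) => // n.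
  apply: weight_lehmer_mono => // s sA; apply: lehmer_mono => i j k ij jk.
  apply: contra (avoid _ _ _ _ _ sA ij jk) => /andP[ik kj]; lia.
(* The branch treated first is 231, 312 and 321; the remaining one is 213. *)
case: (eqVneq (tau o2 : nat) 2%N) => [t2|t2]; last first.
  apply: (weight_growth _ _ (fun n => avoiders n tau)) => // [n|m n s t].
    exact: avoiders1.
  exact: avoiders_dsum.
exists 0; apply: (cvg_ln_linear _ _ _ C0) => // n.
rewrite -weight_rev_compl; apply: weight_lehmer_mono => // _ /imsetP[s sA ->].
apply: lehmer_mono => i j k ij jk; rewrite !permE !ltn_rev_ord.
have ji : (rev_ord j < rev_ord i)%N by rewrite ltn_rev_ord.
have kj : (rev_ord k < rev_ord j)%N by rewrite ltn_rev_ord.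
by apply: contra (avoid _ _ _ _ _ sA kj ji) => /andP[? ?]; lia.
Qed.
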